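(* Under the pointwise product $\otimes$, the polynomial closure spaces $\mathcal{G}_{\le d}$ ($d\in\mathbb{N}$, $d\geq 1$) and $\mathcal{G}_{\mathrm{poly}}$ are infinite divisible abelian torsion groups, and: (1) For every fixed $d\in\mathbb{N}$, $$(\mathcal{G}_{\le d},\otimes)\cong\bigl(\mathbb{Q}_{\le d}[X]/\operatorname{Int}_{\le d}(\mathbb{Z}),+\bigr)\cong(\mathbb{Q}/\mathbb{Z})^{d+1},$$ and every $u\in\mathcal{G}_{\le d}$ is uniquely parameterized by coefficients $c_0,\dots,c_d\in\mathbb{Q}/\mathbb{Z}$ through $$u[m]=\exp\Bigl(2\pi i\sum_{k=0}^d c_k\binom{m}{k}\Bigr),\quad m\in\mathbb{Z}.$$ (2) $$(\mathcal{G}_{\mathrm{poly}},\otimes)\cong(\mathbb{Q}[X]/\operatorname{Int}(\mathbb{Z}),+)\cong\bigoplus_{k=0}^\infty(\mathbb{Q}/\mathbb{Z})\cong\bigoplus_{k=0}^\infty\bigoplus_{p\text{ prime}}\mathbb{Z}(p^\infty),$$ where $\mathbb{Z}(p^\infty)$ is the Prüfer $p$-group.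
   Context: For $\theta:\mathbb{Z}\to\mathbb{R}$ put $\pi(\theta)[m]=\exp(2\pi i\,\theta[m])$. The pointwise product of sequences is $(u\otimes v)[m]=u[m]v[m]$. For $k\ge1$ let $\Theta_{Z^k}[m]=m^k$, and let $\Theta_{\bar 1}[m]=1$, for all $m\in\mathbb{Z}$. For a set $\mathcal{P}$ of functions $\mathbb{Z}\to\mathbb{R}$ let $\mathrm{Cl}(\mathcal{P})$ be the smallest set of functions $\mathbb{Z}\to\mathbb{R}$ containing $\mathcal{P}$ and closed under pointwise addition, negation, and, for all integers $n\ge1$ and $j\in\{0,\dots,n-1\}$, the root operations $\theta\mapsto(\theta+j)/n$. Define $\mathcal{G}_{\le d}=\pi\bigl(\mathrm{Cl}(\{\Theta_{Z^k}\}_{k=1}^d\cup\{\Theta_{\bar1}\})\bigr)$ and $\mathcal{G}_{\mathrm{poly}}=\pi\bigl(\mathrm{Cl}(\{\Theta_{Z^k}\}_{k=1}^\infty\cup\{\Theta_{\bar1}\})\bigr)$. $\operatorname{Int}(\mathbb{Z})=\{P\in\mathbb{Q}[X]\mid P(m)\in\mathbb{Z}\ \forall m\in\mathbb{Z}\}$ is the ring of integer-valued polynomials; $\mathbb{Q}_{\le d}[X]$ is the set of rational polynomials of degree at most $d$ and $\operatorname{Int}_{\le d}(\mathbb{Z})=\operatorname{Int}(\mathbb{Z})\cap\mathbb{Q}_{\le d}[X]$. The binomial polynomials are $\binom{X}{k}=\frac{X(X-1)\cdots(X-k+1)}{k!}$, $k\ge0$. *)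

(* Defs.v *)
From HB Require Import structures.
From mathcomp Require Import all_boot all_order all_algebra.
From mathcomp Require Import all_classical all_reals all_analysis.
From mathcomp Require Import complex.

Set Implicit Arguments.
Unset Strict Implicit.
Unset Printing Implicit Defensive.

Import Order.TTheory GRing.Theory Num.Theory.

Local Open Scope classical_set_scope.
Local Open Scope ring_scope.
Local Open Scope complex_scope.

Definition cexp (R : realType) (z : R[i]) : R[i] :=
  let: a +i* b := z in (expR a)%:C * (cos b +i* sin b).

Definition phase (R : realType) (theta : int -> R) : int -> R[i] :=
  fun m => cexp (2 * (pi : R)%:C * 'i%C * (theta m)%:C).

Definition ptmul (R : realType) (u v : int -> R[i]) : int -> R[i] :=
  fun m => u m * v m.

Definition Theta_pow (R : realType) (k : nat) : int -> R :=
  fun m => m%:~R ^+ k.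

Definition Theta_one (R : realType) : int -> R := fun=> 1.

Definition closed_ops (R : realType) (A : set (int -> R)) : Prop :=
  [/\ forall s t, A s -> A t -> A (fun m => s m + t m),
      forall t, A t -> A (fun m => - t m)
    & forall (n j : nat), (1 <= n)%N -> (j < n)%N ->
        forall t, A t -> A (fun m => (t m + j%:R) / n%:R)].

Definition Cl (R : realType) (P : set (int -> R)) : set (int -> R) :=
  smallest (@closed_ops R) P.

Definition G_le (R : realType) (d : nat) : set (int -> R[i]) :=
  @phase R @`
    Cl ([set Theta_pow R k | k in [set k | (1 <= k <= d)%N]]
        `|` [set Theta_one R]).

Arguments G_le : clear implicits.

Definition G_poly (R : realType) : set (int -> R[i]) :=
  @phase R @`
    Cl ([set Theta_pow R k | k in [set k | (1 <= k)%N]]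
        `|` [set Theta_one R]).

Arguments G_poly : clear implicits.

(* Abelian groups whose carrier is a subset [G] of a type [T]; the ambient
   operation [op] need not be a group law outside [G]. *)
Record abelian_group_on (T : Type) (G : set T) (op : T -> T -> T) (e : T)
  : Prop := AbelianGroupOn {
  ago_op : forall x y, G x -> G y -> G (op x y);
  ago_id : G e;
  ago_inv : forall x, G x -> exists2 y, G y & op x y = e;
  ago_assoc : forall x y z, G x -> G y -> G z ->
    op x (op y z) = op (op x y) z;
  ago_comm : forall x y, G x -> G y -> op x y = op y x;
  ago_idl : forall x, G x -> op e x = x }.

Definition divisible_on (T : Type) (G : set T) (op : T -> T -> T) (e : T) :=
  forall (n : nat) (x : T), (1 <= n)%N -> G x ->
    exists2 y, G y & iter n (op y) e = x.

Definition torsion_on (T : Type) (G : set T) (op : T -> T -> T) (e : T) :=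
  forall x, G x -> exists2 n : nat, (1 <= n)%N & iter n (op x) e = e.

Definition infinite_divisible_torsion_group (T : Type) (G : set T)
    (op : T -> T -> T) : Prop :=
  exists e : T, [/\ abelian_group_on G op e, divisible_on G op e,
                    torsion_on G op e & infinite_set G].

Definition group_iso (T : Type) (G : set T) (op : T -> T -> T)
    (A : zmodType) : Prop :=
  exists f : A -> T,
    set_bij [set: A] G f /\ {morph f : a b / a + b >-> op a b}.

Definition zmod_iso (A B : zmodType) : Prop :=
  exists f : {additive A -> B}, bijective f.

Definition rat_int : {pred rat} := fun x => x \is a Num.int.

Lemma rat_int_zmod_closed : zmod_closed rat_int.
Proof. by split=> [|x y hx hy]; [exact: rpred0 | exact: rpredB]. Qed.

HB.instance Definition _ :=
  GRing.isZmodClosed.Build rat rat_int rat_int_zmod_closed.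

Definition QZ : zmodType := Quotient.quot (rat_int : zmodClosed rat).

Definition int_valued : {pred {poly rat}} :=
  fun P => `[< forall m : int, P.[m%:~R] \is a Num.int >].

Lemma int_valued_zmod_closed : zmod_closed int_valued.
Proof.
split=> [|P Q /asboolP hP /asboolP hQ]; apply/asboolP => m.
  by rewrite horner0 rpred0.
by rewrite hornerD hornerN rpredB ?hP ?hQ.
Qed.

HB.instance Definition _ :=
  GRing.isZmodClosed.Build {poly rat} int_valued int_valued_zmod_closed.

Definition QX_Int : zmodType := Quotient.quot (int_valued : zmodClosed _).

(* [{poly_d.+1 rat}] is the type of polynomials of degree at most [d]. *)
Definition int_valued_le (d : nat) : {pred {poly_d.+1 rat}} :=
  fun P => (P : {poly rat}) \in int_valued.

Lemma int_valued_le_zmod_closed d : zmod_closed (@int_valued_le d).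
Proof. by split=> [|P Q hP hQ]; [exact: rpred0 | exact: rpredB]. Qed.

HB.instance Definition _ d :=
  GRing.isZmodClosed.Build {poly_d.+1 rat} (@int_valued_le d)
    (@int_valued_le_zmod_closed d).

Definition QX_Int_le (d : nat) : zmodType :=
  Quotient.quot (@int_valued_le d : zmodClosed _).

Definition binX (k : nat) : {poly rat} :=
  (k`!%:R)^-1 *: \prod_(i < k) ('X - (i%:R)%:P).

(* The value [exp (2 pi i x)] only depends on [x] modulo [Z]; accordingly the
   formula is required for every choice [q] of representatives of [c]. *)
Definition binomial_phase (R : realType) (d : nat) (c : {ffun 'I_d.+1 -> QZ})
    (u : int -> R[i]) : Prop :=
  forall q : 'I_d.+1 -> rat, (forall k, \pi_QZ%qT (q k) = c k) ->
    u = phase (fun m => ratr (\sum_(k < d.+1) q k * (binX k).[m%:~R])).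

Section DirectSum.
Variables (I : Type) (A : I -> zmodType).

Definition dprod := forall i, A i.

HB.instance Definition _ := gen_eqMixin dprod.
HB.instance Definition _ := gen_choiceMixin dprod.

Definition dprod_zero : dprod := fun=> 0.
Definition dprod_opp (f : dprod) : dprod := fun i => - f i.
Definition dprod_add (f g : dprod) : dprod := fun i => f i + g i.

Lemma dprod_addA : associative dprod_add.
Proof. by move=> f g h; apply: functional_extensionality_dep => i; exact: addrA. Qed.
Lemma dprod_addC : commutative dprod_add.
Proof. by move=> f g; apply: functional_extensionality_dep => i; exact: addrC. Qed.
Lemma dprod_add0 : left_id dprod_zero dprod_add.
Proof. by move=> f; apply: functional_extensionality_dep => i; exact: add0r. Qed.
Lemma dprod_addN : left_inverse dprod_zero dprod_opp dprod_add.
Proof. by move=> f; apply: functional_extensionality_dep => i; exact: addNr. Qed.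

HB.instance Definition _ := GRing.isZmodule.Build dprod
  dprod_addA dprod_addC dprod_add0 dprod_addN.

Definition finsupp : {pred dprod} :=
  fun f => `[< finite_set [set i | f i != 0] >].

Lemma finsupp_zmod_closed : zmod_closed finsupp.
Proof.
split=> [|f g /asboolP hf /asboolP hg]; apply/asboolP.
  by apply: (sub_finite_set _ (finite_set0 I)) => i /=; rewrite eqxx.
apply: (@sub_finite_set _ _ ([set i | f i != 0] `|` [set i | g i != 0])).
  move=> i /= fgi; case: (eqVneq (f i) 0) => [fi|]; last by left.
  right; apply: contra_neq fgi => gi.
  by change (f i - g i = 0); rewrite fi gi subrr.
by rewrite finite_setU.
Qed.

HB.instance Definition _ :=
  GRing.isZmodClosed.Build dprod finsupp finsupp_zmod_closed.

Record dsum_type := DSum {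
  dsum_val :> dprod;
  dsum_finsupp : dsum_val \in finsupp }.

HB.instance Definition _ := [isSub for dsum_val].
HB.instance Definition _ := [Choice of dsum_type by <:].
HB.instance Definition _ := [SubChoice_isSubZmodule of dsum_type by <:].

Definition dsum : zmodType := dsum_type.

End DirectSum.

(* The Prüfer group is taken to be [Z[1/p] / Z]. *)
Section Prufer.
Variable p : nat.

Definition p_denom : {pred rat} :=
  fun x => `[< exists n : nat, (p ^ n)%:R * x \is a Num.int >].

Lemma p_denom_zmod_closed : zmod_closed p_denom.
Proof.
split=> [|x y /asboolP[m hm] /asboolP[n hn]]; apply/asboolP.
  by exists 0%N; rewrite mulr0 rpred0.
exists (m + n)%N; rewrite expnD mulrBr natrM; apply: rpredB.
  by rewrite [X in X * _]mulrC -mulrA rpredM ?natr_int.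
by rewrite -mulrA rpredM ?natr_int.
Qed.

HB.instance Definition _ :=
  GRing.isZmodClosed.Build rat p_denom p_denom_zmod_closed.

Record Zinv := MkZinv {
  Zinv_val :> rat;
  Zinv_denom : Zinv_val \in p_denom }.

HB.instance Definition _ := [isSub for Zinv_val].
HB.instance Definition _ := [Choice of Zinv by <:].
HB.instance Definition _ := [SubChoice_isSubZmodule of Zinv by <:].

Definition Zinv_int : {pred Zinv} := fun x => (x : rat) \is a Num.int.

Lemma Zinv_int_zmod_closed : zmod_closed Zinv_int.
Proof. by split=> [|x y hx hy]; [exact: rpred0 | exact: rpredB]. Qed.

HB.instance Definition _ :=
  GRing.isZmodClosed.Build Zinv Zinv_int Zinv_int_zmod_closed.

Definition Prufer : zmodType := Quotient.quot (Zinv_int : zmodClosed _).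

End Prufer.

(* Main.v *)
From HB Require Import structures.
Require Import Defs.
From mathcomp Require Import all_boot all_order all_algebra.
From mathcomp Require Import all_classical all_reals all_analysis.
From mathcomp Require Import complex.
From mathcomp Require Import ring lra.

Set Implicit Arguments.
Unset Strict Implicit.
Unset Printing Implicit Defensive.

Import Order.TTheory GRing.Theory Num.Theory.

Local Open Scope classical_set_scope.
Local Open Scope ring_scope.
Local Open Scope quotient_scope.

(** A phase sequence [m |-> exp (2 pi i theta m)] forgets exactly the integers:
    two of them agree iff the two functions [theta] differ by integers at every
    point ([phase_eqP]), and [phase] turns sums into pointwise products
    ([phaseD]).

    The root operations with [j = 0], together with addition and negation, make
    a closed set of functions stable under multiplication by rationals; the
    operations with [j > 0] only add rational constants, which are multiples of
    [Theta_one]. So the closure of a family of monomials and of [Theta_one] is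
    the set of rational polynomial functions built on these monomials and
    constants ([Cl_peval]). Hence the two spaces are images of spaces of
    rational polynomials under [P |-> phase P], an additive map whose kernel
    consists of the integer-valued polynomials ([pphase_eqP]), and they are the
    corresponding quotients ([group_iso_quot]). Such a quotient is divisible
    because it comes from a rational vector space, torsion because a polynomial
    has a common denominator, and infinite because it contains a copy of [Q/Z]
    given by the constants.

    The structure of the quotients comes from Newton's forward difference
    formula: a polynomial of degree at most [d] is
    [\sum_(k <= d) bincoef k P *: binX k], where [bincoef k P] is the [k]-th
    iterated difference at [0] ([Newton_expansion]). Differences of an
    integer-valued polynomial are integer-valued, and so are the binomial
    polynomials; hence [P] is integer-valued iff all its coefficients
    [bincoef k P] are integers ([int_valued_bincoefP]). Reducing the
    coefficients modulo [Z] thus identifies the quotients with the finite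
    powers of [Q/Z] and with the countable direct sum of copies of [Q/Z].

    Finally [Q/Z] splits into its primary parts. Modulo the rationals whose
    denominator is prime to [p], a rational [x] is congruent to an element of
    [Z[1/p]], unique modulo [Z]; its class in the Pruefer group is the
    [p]-component of [x]. All the components vanish only if no prime divides
    the denominator, that is for integers, and any finite family of components
    is realised by the sum of its representatives ([QZ_primary]). *)

(** * Quotients of additive groups *)

Section Quotients.
Variables (V : zmodType) (S : zmodClosed V).

Lemma quot_eqP x y :
  reflect (\pi_(Quotient.quot S) x = \pi_(Quotient.quot S) y) (x - y \in S).
Proof. by rewrite Quotient.idealrBE; apply: eqP. Qed.

Lemma quot_eq0P x : reflect (\pi_(Quotient.quot S) x = 0) (x \in S).
Proof.
by rewrite -(raddf0 \pi_(Quotient.quot S)) -{2}[x]subr0; apply: quot_eqP.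
Qed.

(** First isomorphism theorem; the inverse is given by a choice of
    preimages. *)
Lemma zmod_iso_quot (B : zmodType) (h : {additive V -> B}) :
  (forall b, exists v, h v = b) -> (forall v, (h v = 0) <-> v \in S) ->
  zmod_iso (Quotient.quot S) B.
Proof.
move=> h_surj h_ker.
have hE x y : (h x = h y) <-> \pi_(Quotient.quot S) x = \pi y.
  split=> [hxy | /quot_eqP/h_ker]; last by rewrite raddfB => /subr0_eq.
  by apply/quot_eqP/h_ker; rewrite raddfB hxy subrr.
pose f (a : Quotient.quot S) : B := h (repr a).
have f_pi v : f (\pi v) = h v by apply/hE; rewrite reprK.
have fB : zmod_morphism f.
  by move=> a b; rewrite -[a in LHS]reprK -[b in LHS]reprK -raddfB f_pi raddfB.
pose F : {additive _ -> _} := HB.pack f (GRing.isZmodMorphism.Build _ _ f fB).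
exists F; have [g gK] := choice h_surj.
exists (fun b => \pi_(Quotient.quot S) (g b)) => [a | b] /=.
  by rewrite -[RHS]reprK; apply/hE; rewrite gK.
by rewrite [LHS]f_pi gK.
Qed.

(** The first isomorphism theorem for a target that is only a type with an
    operation: the range gets its group law from the quotient. *)
Lemma group_iso_quot (T : Type) (psi : V -> T) (op : T -> T -> T) :
  {morph psi : x y / x + y >-> op x y} ->
  (forall x y, (psi x = psi y) <-> x - y \in S) ->
  group_iso (range psi) op (Quotient.quot S).
Proof.
move=> psiD psiE; exists (fun a => psi (repr a)).
have psi_pi v : psi (repr (\pi_(Quotient.quot S) v)) = psi v.
  by apply/psiE/quot_eqP; rewrite reprK.
split; first split=> [a _ | a b _ _ /psiE/quot_eqP | u [v _ <-]].
- by exists (repr a).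
- by rewrite !reprK.
- by exists (\pi v).
by move=> a b; rewrite -psiD -[a in LHS]reprK -[b in LHS]reprK -raddfD psi_pi.
Qed.

End Quotients.

(** Iterating [op (f a)] from [f 0] computes [f (a *+ n)], so all the properties
    can be read off in [A]. *)
Lemma infinite_divisible_torsion_iso (A : zmodType) (T : Type) (G : set T)
    (op : T -> T -> T) :
  group_iso G op A ->
  (forall n (a : A), (0 < n)%N -> exists b, b *+ n = a) ->
  (forall a : A, exists2 n, (0 < n)%N & a *+ n = 0) ->
  (exists g : nat -> A, injective g) ->
  infinite_divisible_torsion_group G op.
Proof.
move=> [f [[fG f_inj f_surj] fD]] div tor [g g_inj].
have iterE n a : iter n (op (f a)) (f 0) = f (a *+ n).
  by elim: n => [|n IHn]; rewrite ?mulr0n // iterS IHn -fD mulrS.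
have G_f x : G x -> exists a, x = f a.
  by move=> /f_surj [a _ <-]; exists a.
have f_G a : G (f a) by apply: fG.
exists (f 0); split.
- split=> //.
  + by move=> _ _ /G_f[a ->] /G_f[b ->]; rewrite -fD.
  + by move=> _ /G_f[a ->]; exists (f (- a)); rewrite // -fD subrr.
  + by move=> _ _ _ /G_f[a ->] /G_f[b ->] /G_f[c ->]; rewrite -!fD addrA.
  + by move=> _ _ /G_f[a ->] /G_f[b ->]; rewrite -!fD addrC.
  + by move=> _ /G_f[a ->]; rewrite -fD add0r.
- move=> n _ n_gt0 /G_f[a ->]; have [b <-] := div n a n_gt0.
  by exists (f b).
- move=> _ /G_f[a ->]; have [n n_gt0 an0] := tor a.
  by exists n; rewrite // iterE an0.
- move=> finG; apply: infinite_nat.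
  apply: (sub_finite_set _ (@finite_preimage _ _ G (f \o g) _ finG)).
    by move=> k _ /=; apply: f_G.
  by move=> k l _ _ /(f_inj _ _ (in_setT _) (in_setT _))/g_inj.
Qed.

Lemma quot_divisible (V : lmodType rat) (S : zmodClosed V) n
    (a : Quotient.quot S) : (0 < n)%N -> exists b, b *+ n = a.
Proof.
move=> n_gt0; exists (\pi_(Quotient.quot S) (n%:R^-1 *: repr a)).
rewrite -raddfMn /= -scaler_nat scalerA divff ?scale1r ?reprK //.
by rewrite pnatr_eq0 -lt0n.
Qed.

(** The multiples of [v] by [1/2], [1/3], [1/4], ... are pairwise incongruent
    modulo [S], since two of these fractions never differ by a nonzero
    integer. *)
Lemma quot_infinite (V : lmodType rat) (S : zmodClosed V) (v : V) :
  (forall r : rat, r *: v \in S -> r \is a Num.int) ->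
  exists g : nat -> Quotient.quot S, injective g.
Proof.
move=> v_int.
exists (fun k => \pi_(Quotient.quot S) (k.+2%:R^-1 *: v)) => k l /quot_eqP.
rewrite -scalerBl => /v_int; set r := (X in X \is a _) => r_int.
have k2_gt1 (n : nat) : 0 < n.+2%:R^-1 :> rat /\ n.+2%:R^-1 < 1 :> rat.
  by rewrite invr_gt0 invf_lt1 ?ltr0n // ltr1n.
have r_lt1 : `|r| < 1.
  have [] := k2_gt1 k; have [] := k2_gt1 l; rewrite ltr_norml /r.
  by move: k.+2%:R^-1 l.+2%:R^-1 => x y; lra.
have r0 : r = 0.
  by apply/eqP; apply: contraLR r_lt1; rewrite -leNgt; apply: norm_intr_ge1.
by move/subr0_eq/invr_inj/eqP: r0; rewrite eqr_nat => /eqP[].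
Qed.

Lemma QZ_eqP (x y : rat) : reflect (\pi_QZ x = \pi_QZ y) (x - y \is a Num.int).
Proof. exact: (quot_eqP (rat_int : zmodClosed rat)). Qed.

Lemma QZ_eq0P (x : rat) : reflect (\pi_QZ x = 0) (x \is a Num.int).
Proof. exact: (quot_eq0P (rat_int : zmodClosed rat)). Qed.

(** * Direct sums *)

Lemma dsum_eqP (I : Type) (A : I -> zmodType) (s t : dsum A) :
  (forall i, dsum_val s i = dsum_val t i) -> s = t.
Proof.
by move=> st; apply: val_inj; apply: functional_extensionality_dep.
Qed.

Lemma dsumB (I : Type) (A : I -> zmodType) (s t : dsum A) i :
  dsum_val (s - t) i = dsum_val s i - dsum_val t i.
Proof. by []. Qed.

Lemma dsum_map_iso (I : Type) (A B : zmodType) :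
  zmod_iso A B -> zmod_iso (dsum (fun _ : I => A)) (dsum (fun _ : I => B)).
Proof.
move=> [f [g fK gK]].
have fsupp (C D : zmodType) (k : C -> D) (s : dsum (fun _ : I => C)) :
    k 0 = 0 ->
    (fun i => k (dsum_val s i)) \in @finsupp I (fun=> D).
  move=> k0; apply/asboolP; have /asboolP := dsum_finsupp s.
  by apply: sub_finite_set => i /=; apply: contra_neq => ->.
have g0 : g 0 = 0 by rewrite -(raddf0 f) fK.
pose F (s : dsum (fun _ : I => A)) : dsum (fun _ : I => B) :=
  DSum (fsupp _ _ _ s (raddf0 f)).
have FB : zmod_morphism F.
  by move=> s t; apply: dsum_eqP => i; exact: raddfB.
exists (HB.pack F (GRing.isZmodMorphism.Build _ _ F FB) : {additive _ -> _}).
exists (fun s => DSum (fsupp _ _ _ s g0)) => s; apply: dsum_eqP => i /=.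
  exact: fK.
exact: gK.
Qed.

(** * Newton expansions and integer-valued polynomials *)

Section Newton.
Implicit Types (P Q : {poly rat}) (k n : nat).

(** The forward difference operator, which lowers the index of the binomial
    polynomials as differentiation lowers that of ['X^n / n!]. *)
Definition fdiff P := P \Po ('X + 1) - P.

Lemma fdiff_is_zmod_morphism : zmod_morphism fdiff.
Proof.
move=> P Q; rewrite /fdiff linearB /= !opprD !opprK addrACA; congr (_ + _).
Qed.
HB.instance Definition _ :=
  GRing.isZmodMorphism.Build {poly rat} {poly rat} fdiff fdiff_is_zmod_morphism.

Lemma fdiff_is_scalable : scalable fdiff.
Proof. by move=> a P; rewrite /fdiff linearZ /= scalerBr. Qed.
HB.instance Definition _ :=
  GRing.isScalable.Build rat {poly rat} {poly rat} *:%R fdiff fdiff_is_scalable.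

Lemma horner_fdiff P x : (fdiff P).[x] = P.[x + 1] - P.[x].
Proof. by rewrite /fdiff hornerD hornerN horner_comp !hornerE. Qed.

Lemma binX0 : binX 0 = 1.
Proof. by rewrite /binX big_ord0 fact0 invr1 scale1r. Qed.

Lemma fdiff_binX k : fdiff (binX k.+1) = binX k.
Proof.
rewrite /binX linearZ /= factS natrM invfM mulrC -scalerA; congr (_ *: _).
have -> : fdiff (\prod_(i < k.+1) ('X - i%:R%:P)) =
    k.+1%:R *: \prod_(i < k) ('X - i%:R%:P).
  (* Shifting by one turns the factor of index i + 1 into the one of index i, so
     both terms of the difference are A times a linear factor. *)
  set A := \prod_(i < k) _; rewrite /fdiff.
  have -> : \prod_(i < k.+1) ('X - i%:R%:P) \Po ('X + 1) = ('X + 1) * A.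
    rewrite big_ord_recl rmorphM rmorph_prod /= subr0 comp_polyX.
    congr (_ * _); apply: eq_bigr => i _.
    rewrite comp_polyB comp_polyX comp_polyC /bump /=.
    by rewrite natrD polyCD opprD addrA addrK.
  rewrite big_ord_recr /= mulrC -mulrBr opprB addrC addrA subrK.
  by rewrite -polyC1 -polyCD -natr1 mulrC mul_polyC.
by rewrite scalerA mulVf ?scale1r // pnatr_eq0.
Qed.

Lemma horner0_binX k : (binX k.+1).[0] = 0.
Proof.
rewrite /binX hornerZ horner_prod big_ord_recl /=.
by rewrite hornerXsubC subrr mul0r mulr0.
Qed.

(** The coordinate of [P] on [binX k], by [bincoef_binX] below. *)
Definition bincoef k P := (iter k fdiff P).[0].

Lemma bincoef_is_zmod_morphism k : zmod_morphism (bincoef k).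
Proof.
move=> P Q; rewrite /bincoef.
have -> : iter k fdiff (P - Q) = iter k fdiff P - iter k fdiff Q.
  by elim: k => //= k ->; rewrite raddfB.
by rewrite hornerD hornerN.
Qed.
HB.instance Definition _ k := GRing.isZmodMorphism.Build {poly rat} rat
  (bincoef k) (bincoef_is_zmod_morphism k).

Lemma bincoef_is_scalable k : scalable_for *%R (bincoef k).
Proof.
move=> a P; rewrite /bincoef -hornerZ; congr (_.[0]).
by elim: k => //= k ->; rewrite linearZ.
Qed.
HB.instance Definition _ k := GRing.isScalable.Build rat {poly rat} rat *%R
  (bincoef k) (bincoef_is_scalable k).

Lemma bincoef_binX k j : bincoef k (binX j) = (k == j)%:R.
Proof.
elim: k j => [|k IHk] [|j]; rewrite /bincoef.
- by rewrite binX0 hornerC.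
- by rewrite /= horner0_binX.
- have fdiff1 : fdiff 1 = 0 by rewrite /fdiff rmorph1 subrr.
  rewrite binX0 iterSr fdiff1.
  have -> : iter k fdiff 0 = 0 by elim: k {IHk} => //= k ->; rewrite raddf0.
  by rewrite horner0.
by rewrite iterSr fdiff_binX -/(bincoef k _) IHk.
Qed.

Lemma size_binX k : size (binX k) = k.+1.
Proof.
rewrite /binX size_scale ?invr_eq0 ?pnatr_eq0 -?lt0n ?fact_gt0 //.
by rewrite size_prod_XsubC /index_enum -enumT size_enum_ord.
Qed.

(** The family [q] is indexed by [nat] so that one [q] serves for all
    lengths. *)
Definition binsum n (q : nat -> rat) := \sum_(k < n) q k *: binX k.

Lemma size_binsum n q : (size (binsum n q) <= n)%N.
Proof.
apply: (leq_trans (size_sum _ _ _)); apply/bigmax_leqP => i _.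
by rewrite (leq_trans (size_scale_leq _ _)) // size_binX.
Qed.

Lemma bincoef_binsum n q k :
  bincoef k (binsum n q) = if (k < n)%N then q k else 0.
Proof.
rewrite /binsum raddf_sum /=; case: ltnP => [lt_kn | le_nk].
  rewrite (bigD1 (Ordinal lt_kn)) //= linearZ /= bincoef_binX eqxx mulr1.
  rewrite big1 ?addr0 // => i; rewrite -val_eqE /= eq_sym => /negPf ik.
  by rewrite linearZ /= bincoef_binX ik mulr0.
apply: big1 => i _; rewrite linearZ /= bincoef_binX gtn_eqF ?mulr0 //.
exact: leq_trans le_nk.
Qed.

(** It suffices to find some expansion, as its coefficients can be read off with
    [bincoef]; one exists by removing the leading term, [binX n] having degree
    exactly [n]. *)
Lemma Newton_expansion n P : (size P <= n)%N -> P = binsum n (bincoef^~ P).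
Proof.
move=> szP; suff [q Pq] : exists q, P = binsum n q.
  rewrite [LHS]Pq; apply: eq_bigr => k _.
  by rewrite Pq bincoef_binsum ltn_ord.
elim: n P szP => [|n IHn] P szP.
  exists (fun=> 0); rewrite /binsum big_ord0; apply/eqP.
  by rewrite -size_poly_leq0.
pose a := P`_n / (binX n)`_n.
have [|q Pq] := IHn (P - a *: binX n).
  apply/leq_sizeP => j; rewrite leq_eqVlt => /predU1P[<- | lt_nj].
    rewrite coefB coefZ /a divfK ?subrr //.
    rewrite -[n in _`_n]/(n.+1.-1) -size_binX -/(lead_coef _).
    by rewrite lead_coef_eq0 -size_poly_gt0 size_binX.
  rewrite coefB coefZ !nth_default ?mulr0 ?subrr ?size_binX //.
  exact: leq_trans szP lt_nj.
exists (fun k => if (k < n)%N then q k else a).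
rewrite /binsum big_ord_recr /= ltnn -[LHS](subrK (a *: binX n)) Pq.
by congr (_ + _); apply: eq_bigr => i _; rewrite ltn_ord.
Qed.

Lemma int_valuedP P :
  reflect (forall m : int, P.[m%:~R] \is a Num.int) (P \in int_valued).
Proof. exact: asboolP. Qed.

Lemma int_valued_fdiff P : P \in int_valued -> fdiff P \in int_valued.
Proof.
move=> /int_valuedP P_int; apply/int_valuedP => m.
by rewrite horner_fdiff -[1]/(1%:~R) -intrD rpredB.
Qed.

(** The values at all integers are reached from the value at [0] by adding or
    subtracting values of the difference. *)
Lemma int_valued_of_fdiff P :
  P.[0] \is a Num.int -> fdiff P \in int_valued -> P \in int_valued.
Proof.
move=> P0_int /int_valuedP DP_int; apply/int_valuedP; elim=> [|n|n] //.
  move=> Pn_int; rewrite -addn1 PoszD intrD.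
  by rewrite -[_.[_]](subrK P.[n%:~R]) -horner_fdiff rpredD.
move=> Pn_int; have := DP_int (- n.+1%:Z); rewrite horner_fdiff.
have -> : (- n.+1%:Z)%:~R + 1 = (- n%:Z)%:~R :> rat.
  by rewrite -addn1 PoszD opprD intrD addrNK.
by move=> ?; rewrite -[X in X \is a _](subKr P.[(- n%:Z)%:~R]) rpredB.
Qed.

Lemma binX_int_valued k : binX k \in int_valued.
Proof.
elim: k => [|k IHk].
  by apply/int_valuedP => m; rewrite binX0 hornerC rpred1.
by apply: int_valued_of_fdiff; rewrite ?horner0_binX ?rpred0 ?fdiff_binX.
Qed.

Lemma binsum_int_valued n q :
  (forall k, (k < n)%N -> q k \is a Num.int) -> binsum n q \in int_valued.
Proof.
move=> q_int; apply: rpred_sum => k _; apply/int_valuedP => m.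
rewrite hornerZ rpredM ?q_int //; move: m; exact/int_valuedP/binX_int_valued.
Qed.

Lemma bincoef_int P k : P \in int_valued -> bincoef k P \is a Num.int.
Proof.
move=> P_int; suff /int_valuedP/(_ 0) : iter k fdiff P \in int_valued by [].
by elim: k => //= k; apply: int_valued_fdiff.
Qed.

Lemma int_valued_bincoefP n P : (size P <= n)%N ->
  (P \in int_valued) <-> (forall k, (k < n)%N -> bincoef k P \is a Num.int).
Proof.
move=> szP; split=> [P_int k _ | Pk_int]; first exact: bincoef_int.
by rewrite (Newton_expansion szP); apply: binsum_int_valued.
Qed.

Lemma bincoef_eq0 n P k : (size P <= n)%N -> (n <= k)%N -> bincoef k P = 0.
Proof.
move=> szP le_nk; rewrite (Newton_expansion szP) bincoef_binsum.
by rewrite ltnNge le_nk.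
Qed.

(** A common denominator of the coefficients clears all values at integers; it is
    built along Horner's scheme. *)
Lemma int_valued_torsion P : exists2 n, (0 < n)%N & P *+ n \in int_valued.
Proof.
elim/poly_ind: P => [|P c [n n_gt0 nP_int]].
  by exists 1%N => //; exact: rpred0.
exists (n * `|denq c|)%N; first by rewrite muln_gt0 n_gt0 absz_gt0 denq_neq0.
move/int_valuedP: nP_int => nP_int; apply/int_valuedP => m.
have := nP_int m; rewrite !hornerMn hornerMXaddC mulrnDl => Pm_int.
apply: rpredD.
  by rewrite mulrnA rpredMn // -mulrnAl rpredM ?intr_int.
rewrite mulnC mulrnA rpredMn // -mulr_natr natr_absz.
by rewrite gtr0_norm ?denq_gt0 //= -numqE intr_int.
Qed.

End Newton.

(** Reducing the Newton coefficients modulo [Z] is onto since they are arbitrary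
    rationals, and kills exactly the integer-valued polynomials. *)
Lemma QX_Int_le_iso (d : nat) : zmod_iso (QX_Int_le d) {ffun 'I_d.+1 -> QZ}.
Proof.
pose h (P : {poly_d.+1 rat}) : {ffun 'I_d.+1 -> QZ} :=
  [ffun k : 'I_d.+1 => \pi_QZ (bincoef k P)].
have hB : zmod_morphism h.
  by move=> P Q; apply/ffunP => k; rewrite !ffunE /= raddfB /= raddfB.
pose H : {additive _ -> _} := HB.pack h (GRing.isZmodMorphism.Build _ _ h hB).
apply: (@zmod_iso_quot _ _ _ H) => [c | P].
  have szq := size_binsum d.+1 (fun k => repr (c (inord k))).
  exists (NPoly szq); apply/ffunP => k.
  by rewrite ffunE /= bincoef_binsum ltn_ord inord_val reprK.
have szP := size_npoly P; split=> [hP0 | P_int].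
  apply/(int_valued_bincoefP szP) => k lt_kd.
  by have /ffunP/(_ (Ordinal lt_kd)) := hP0; rewrite !ffunE => /QZ_eq0P.
by apply/ffunP => k; rewrite !ffunE; apply/QZ_eq0P/bincoef_int.
Qed.

Lemma finsupp_bincoef (P : {poly rat}) :
  (fun k => \pi_QZ (bincoef k P) : QZ) \in @finsupp nat (fun=> QZ).
Proof.
apply/asboolP; apply: (sub_finite_set _ (finite_II (size P))) => k /=.
by apply: contraNT; rewrite -leqNgt => /bincoef_eq0 ->; rewrite ?raddf0.
Qed.

Lemma QX_Int_iso : zmod_iso QX_Int (dsum (fun _ : nat => QZ)).
Proof.
pose h (P : {poly rat}) : dsum (fun _ : nat => QZ) := DSum (finsupp_bincoef P).
have hB : zmod_morphism h.
  by move=> P Q; apply: dsum_eqP => k; rewrite dsumB /= raddfB /= raddfB.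
pose H : {additive _ -> _} := HB.pack h (GRing.isZmodMorphism.Build _ _ h hB).
apply: (@zmod_iso_quot _ _ _ H) => [c | P].
  have /asboolP/finite_seqP[s sE] := dsum_finsupp c.
  pose n := (\max_(k <- s) k).+1.
  exists (binsum n (fun k => repr (dsum_val c k))); apply: dsum_eqP => k /=.
  rewrite bincoef_binsum; case: ltnP => [_ | le_nk]; first by rewrite reprK.
  rewrite raddf0; apply/esym/eqP; apply: contraTT le_nk => ck_neq0.
  have : k \in s by have : [set` s] k by rewrite -sE.
  by move=> ks; rewrite -ltnNge ltnS; apply: leq_bigmax_seq.
split=> [hP0 | P_int].
  apply/(int_valued_bincoefP (leqnn _)) => k _.
  by apply/QZ_eq0P; apply: (congr1 (fun s => dsum_val s k) hP0).
by apply: dsum_eqP => k; apply/QZ_eq0P/bincoef_int.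
Qed.

Lemma QX_Int_torsion (a : QX_Int) : exists2 n, (0 < n)%N & a *+ n = 0.
Proof.
have [n n_gt0 an_int] := int_valued_torsion (repr a); exists n => //.
rewrite -[a]reprK -raddfMn.
exact/(quot_eq0P (int_valued : zmodClosed _)).
Qed.

Lemma QX_Int_le_torsion (d : nat) (a : QX_Int_le d) :
  exists2 n, (0 < n)%N & a *+ n = 0.
Proof.
have [n n_gt0 an_int] := int_valued_torsion (repr a); exists n => //.
rewrite -[a]reprK -raddfMn; apply/(quot_eq0P (@int_valued_le d : zmodClosed _)).
by rewrite [_ \in _]/(_ \in int_valued) raddfMn.
Qed.

(** * Phases *)

Section Phase.
Variable R : realType.

Lemma phaseE (theta : int -> R) (m : int) :
  phase theta m = (cos (2 * pi * theta m) +i* sin (2 * pi * theta m))%C.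
Proof.
rewrite /phase /cexp.
have -> : (2 * (pi : R)%:C * 'i * (theta m)%:C = 0 +i* (2 * pi * theta m))%C.
  by simpc.
by rewrite expR0; simpc.
Qed.

Lemma phaseD (s t : int -> R) :
  phase (fun m => s m + t m) = ptmul (phase s) (phase t).
Proof.
apply: funext => m; rewrite /ptmul !phaseE mulrDr cosD sinD.
by apply/eqP; rewrite eq_complex /= eqxx /= [eqbRHS]addrC eqxx.
Qed.

Lemma cos_sin_intr (k : int) :
  cos (2 * pi * k%:~R) = 1 :> R /\ sin (2 * pi * k%:~R) = 0 :> R.
Proof.
have natP (n : nat) :
    cos (2 * pi * n%:R) = 1 :> R /\ sin (2 * pi * n%:R) = 0 :> R.
  have -> : 2 * pi * n%:R = 0 + (pi *+ 2) *+ n :> R.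
    by rewrite add0r mulr_natr mulr_natl.
  by rewrite (periodicn (@cosD2pi R)) (periodicn (@sinD2pi R)) cos0 sin0.
case: k => n; first exact: natP.
rewrite NegzE mulrNz mulrN cosN sinN; have [-> ->] := natP n.+1.
by rewrite oppr0.
Qed.

(** Remove the integer part of [x]. For [t] in [(0, 1)], the double angle formula
    gives [cos (2 pi t) = 1 - 2 sin (pi t) ^ 2], which is less than [1]. *)
Lemma cos_eq1 (x : R) : (cos (2 * pi * x) = 1) <-> x \is a Num.int.
Proof.
split=> [cosx | /intrP[k ->]]; last by have [] := cos_sin_intr k.
have [k] : exists k : int, 0 <= x - k%:~R < 1.
  exists (Num.floor x); have := floor_itv x; rewrite intrD; lra.
set t := x - _ => /andP[t_ge0 t_lt1].
have cost : cos (2 * pi * t) = 1.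
  rewrite mulrBr cosB; have [-> ->] := cos_sin_intr k.
  by rewrite cosx mulr0 addr0 mulr1.
suff t0 : t = 0 by apply/intrP; exists k; apply: subr0_eq.
apply: contra_eq cost => t_neq0; rewrite lt_eqF//.
have /sin_gt0_pi sin_gt0 : 0 < pi * t < pi.
  rewrite mulr_gt0 ?pi_gt0 ?lt0r ?t_neq0//=.
  by rewrite -[ltRHS]mulr1 ltr_pM2l ?pi_gt0.
have -> : 2 * pi * t = (pi * t) *+ 2 by rewrite -[RHS]mulr_natl mulrA.
rewrite cos_mulr2n cos2sin2.
have : 0 < sin (pi * t) ^+ 2 by rewrite exprn_gt0.
lra.
Qed.

Lemma phase_eqP (s t : int -> R) :
  phase s = phase t <-> forall m, s m - t m \is a Num.int.
Proof.
split=> [st m | st_int].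
  have /eqP := congr1 (@^~ m) st; rewrite !phaseE eq_complex /=.
  move=> /andP[/eqP cos_st /eqP sin_st]; apply/cos_eq1.
  by rewrite mulrBr cosB cos_st sin_st -!expr2 cos2Dsin2.
apply: funext => m; rewrite !phaseE.
have /intrP[k stk] := st_int m; have -> : s m = t m + k%:~R.
  by rewrite -stk addrC subrK.
rewrite mulrDr cosD sinD; have [-> ->] := cos_sin_intr k.
by rewrite !mulr1 !mulr0 subr0 addr0.
Qed.

End Phase.

Lemma ratr_int_num (R : realType) (r : rat) :
  ((ratr r : R) \is a Num.int) = (r \is a Num.int).
Proof.
apply/intrP/intrP => [[k rk]|[k ->]]; exists k; last by rewrite ratr_int.
by apply: (fmorph_inj (@ratr R)); rewrite /= rk ratr_int.
Qed.

(** * Polynomial closures *)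

Section Closure.
Variable R : realType.
Implicit Types (P Q : {poly rat}) (A : set (int -> R)) (K : set nat).

Definition peval P : int -> R := fun m => ratr P.[m%:~R].

(** Addition and negation give the integer multiples, and the root operation with
    [j = 0] divides by the denominator. *)
Lemma closed_ops_scale A (r : rat) (s : int -> R) :
  closed_ops A -> A s -> A (fun m => ratr r * s m).
Proof.
move=> [addA oppA rootA] As.
have A0 : A (fun=> 0).
  rewrite (_ : (fun=> 0) = fun m => s m + - s m); first exact/addA/oppA.
  by apply: funext => m; rewrite subrr.
have natA (n : nat) : A (fun m => n%:R * s m).
  elim: n => [|n IHn].
    by move: A0; congr A; apply: funext => m; rewrite mul0r.
  rewrite (_ : (fun m => _) = fun m => n%:R * s m + s m); first exact: addA.
  by apply: funext => m; rewrite -natr1 mulrDl mul1r.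
have intA (k : int) : A (fun m => k%:~R * s m).
  case: k => n; first exact: natA.
  rewrite (_ : (fun m => _) = fun m => - (n.+1%:R * s m)).
    exact/oppA/natA.
  by apply: funext => m; rewrite NegzE mulrNz mulNr.
have d_gt0 : (0 < `|denq r|)%N by rewrite absz_gt0 denq_neq0.
have := rootA _ 0%N d_gt0 d_gt0 _ (intA (numq r)).
congr A; apply: funext => m; rewrite addr0 /ratr mulrAC.
by rewrite natr_absz gtr0_norm ?denq_gt0.
Qed.

Lemma closed_ops_smallest (G : set (int -> R)) : closed_ops (Cl G).
Proof.
split=> [s t Cs Ct B CB | t Ct B CB | n j n_gt0 lt_jn t Ct B CB].
- by case: (CB) => -[addB _ _] _; apply: addB; [apply: Cs | apply: Ct].
- by case: (CB) => -[_ oppB _] _; apply: oppB; apply: Ct.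
- by case: (CB) => -[_ _ rootB] _; apply: rootB => //; apply: Ct.
Qed.

(** Rational polynomial functions with monomials in [K] and constants form a
    closed set, the operation [theta |-> (theta + j) / n] only shifting the
    constant term before a rational scaling; conversely they are rational
    combinations of the generators. *)
Lemma Cl_peval K :
  Cl ([set Theta_pow R k | k in K] `|` [set Theta_one R]) =
  [set peval P | P in
    [set P : {poly rat} | forall k, P`_k != 0 -> k = 0%N \/ K k]].
Proof.
apply/seteqP; split.
  apply: smallest_sub.
    split.
    - move=> _ _ [P PK <-] [Q QK <-]; exists (P + Q).
        move=> k; rewrite coefD; have [->|/PK //] := eqVneq P`_k 0.
        by rewrite add0r => /QK.
      by apply: funext => m; rewrite /peval hornerD rmorphD.
    - move=> _ [P PK <-]; exists (- P).
        by move=> k; rewrite coefN oppr_eq0 => /PK.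
      by apply: funext => m; rewrite /peval hornerN rmorphN.
    - move=> n j n_gt0 _ _ [P PK <-]; exists (n%:R^-1 *: (P + j%:R%:P)).
        move=> k; rewrite coefZ coefD coefC mulf_eq0 negb_or => /andP[_].
        by case: (k =P 0%N) => [|_]; [left | rewrite addr0 => /PK].
      apply: funext => m; rewrite /peval hornerZ hornerD hornerC.
      by rewrite rmorphM rmorphD fmorphV !rmorph_nat mulrC.
  move=> _ [[k Kk <-] | ->].
    exists 'X^k.
      move=> j; rewrite coefXn.
      by case: (j =P k) => [->|_]; [right | rewrite eqxx].
    by apply: funext => m; rewrite /peval hornerXn rmorphXn /= ratr_int.
  exists 1.
    move=> j; rewrite coef1.
    by case: (j =P 0%N) => [->|_]; [left | rewrite eqxx].
  by apply: funext => m; rewrite /peval hornerC rmorph1.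
move=> _ [P PK <-]; set G := _ `|` _.
have CG := closed_ops_smallest G; have [addC _ _] := CG.
have one_C : Cl G (Theta_one R) by apply: sub_gen_smallest; right.
have scale_C := closed_ops_scale _ CG.
have zero_C : Cl G (fun=> 0).
  have := scale_C 0 _ one_C; congr (Cl _); apply: funext => m.
  by rewrite rmorph0 mul0r.
have mono_C i : Cl G (fun m => ratr P`_i * m%:~R ^+ i).
  have [-> | Pi_neq0] := eqVneq P`_i 0.
    by move: zero_C; congr (Cl _); apply: funext => m; rewrite rmorph0 mul0r.
  apply: scale_C; have [-> | Ki] := PK i Pi_neq0; first exact: one_C.
  by apply: sub_gen_smallest; left; exists i.
have -> : peval P = fun m => \sum_(i < size P) ratr P`_i * m%:~R ^+ i.
  apply: funext => m; rewrite /peval horner_coef rmorph_sum.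
  by apply: eq_bigr => i _; rewrite rmorphM rmorphXn /= ratr_int.
elim: (size P) => [|n IHn].
  by move: zero_C; congr (Cl _); apply: funext => m; rewrite big_ord0.
rewrite (_ : (fun m => _) = fun m =>
  \sum_(i < n) ratr P`_i * m%:~R ^+ i + ratr P`_n * m%:~R ^+ n).
  exact: addC.
by apply: funext => m; rewrite big_ord_recr.
Qed.

Definition pphase P : int -> R[i] := phase (peval P).

Lemma pphaseD : {morph pphase : P Q / P + Q >-> ptmul P Q}.
Proof.
move=> P Q; rewrite /pphase -phaseD; congr phase.
by apply: funext => m; rewrite /peval hornerD rmorphD.
Qed.

Lemma pphase_eqP P Q : pphase P = pphase Q <-> P - Q \in int_valued.
Proof.
rewrite /pphase phase_eqP; split=> [PQ_int | /int_valuedP PQ_int].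
  apply/int_valuedP => m; rewrite hornerD hornerN -(ratr_int_num R) rmorphB.
  exact: PQ_int.
by move=> m; rewrite /peval -rmorphB ratr_int_num -hornerN -hornerD PQ_int.
Qed.

Lemma G_polyE : G_poly R = range pphase.
Proof.
rewrite /G_poly Cl_peval; apply/seteqP; split=> u.
  by move=> [_ [P _ <-] <-]; exists P.
move=> [P _ <-]; exists (peval P) => //.
by exists P => // -[|k]; [left | right].
Qed.

Lemma G_leE d :
  G_le R d = [set pphase P | P in [set P : {poly rat} | (size P <= d.+1)%N]].
Proof.
rewrite /G_le Cl_peval; apply/seteqP; split=> u.
  move=> [_ [P PK <-] <-]; exists P => //=; apply/leq_sizeP => k lt_dk.
  apply/eqP; apply: contraT => /PK [k0 | /= /andP[_]].
    by rewrite k0 in lt_dk.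
  by rewrite leqNgt lt_dk.
move=> [P /= szP <-]; exists (peval P) => //.
exists P => // -[|k] Pk; first by left.
right=> /=; rewrite -ltnS; apply: leq_trans szP; rewrite ltnNge.
by apply: contra Pk => /leq_sizeP ->.
Qed.

Lemma npoly_range d (T : Type) (f : {poly rat} -> T) :
  [set f P | P in [set P : {poly rat} | (size P <= d.+1)%N]] =
  range (fun P : {poly_d.+1 rat} => f P).
Proof.
apply/seteqP; split=> u [P]; last by exists P => //=; apply: size_npoly.
by move=> szP <-; exists (NPoly szP).
Qed.

Lemma G_le_iso d : group_iso (G_le R d) (@ptmul R) (QX_Int_le d).
Proof.
rewrite G_leE npoly_range; apply: group_iso_quot => [P Q | P Q].
  exact: pphaseD.
exact: pphase_eqP.
Qed.

Lemma G_poly_iso : group_iso (G_poly R) (@ptmul R) QX_Int.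
Proof.
rewrite G_polyE.
by apply: group_iso_quot; [exact: pphaseD | exact: pphase_eqP].
Qed.

(** By Newton's formula [P] is itself a binomial sum, and two such sums give the
    same phase iff their difference is integer-valued, iff their coefficients
    agree modulo [Z]. *)
Lemma binomial_phaseP d (c : {ffun 'I_d.+1 -> QZ}) P : (size P <= d.+1)%N ->
  binomial_phase c (pphase P) <->
  forall k : 'I_d.+1, c k = \pi_QZ (bincoef k P).
Proof.
move=> szP.
have binsumE (q : 'I_d.+1 -> rat) :
    phase (fun m => ratr (\sum_(k < d.+1) q k * (binX k).[m%:~R])) =
    pphase (binsum d.+1 (q \o inord)).
  rewrite /pphase; congr phase; apply: funext => m.
  rewrite /peval horner_sum; congr ratr.
  by apply: eq_bigr => k _; rewrite [RHS]hornerZ /= inord_val.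
have coefE (q : 'I_d.+1 -> rat) (k : 'I_d.+1) :
    bincoef k (P - binsum d.+1 (q \o inord)) = bincoef k P - q k.
  by rewrite raddfB /= bincoef_binsum ltn_ord /= inord_val.
have sz_diff (q : 'I_d.+1 -> rat) :
    (size (P - binsum d.+1 (q \o inord))%R <= d.+1)%N.
  rewrite (leq_trans (size_polyD _ _)) // geq_max szP size_polyN.
  exact: size_binsum.
have diffP (q : 'I_d.+1 -> rat) :
    pphase P = pphase (binsum d.+1 (q \o inord)) <->
    forall k : 'I_d.+1, bincoef k P - q k \is a Num.int.
  rewrite pphase_eqP (int_valued_bincoefP (sz_diff q)).
  split=> [PqZ k | PqZ k lt_kd]; first by rewrite -coefE; apply: PqZ.
  by rewrite -[k]/(nat_of_ord (Ordinal lt_kd)) coefE.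
split=> [cP k | cP q qc].
  (* The formula holds for all representatives, in particular for the canonical
     ones. *)
  have /cP : forall k, \pi_QZ%qT (repr (c k)) = c k by move=> j; rewrite reprK.
  by rewrite binsumE => /diffP/(_ k)/QZ_eqP ->; rewrite reprK.
rewrite binsumE; apply/diffP => k.
by apply/QZ_eqP; rewrite qc cP.
Qed.

Lemma G_le_unique_coefficients d u : G_le R d u ->
  exists! c : {ffun 'I_d.+1 -> QZ}, binomial_phase c u.
Proof.
rewrite G_leE => -[P szP <-].
exists [ffun k : 'I_d.+1 => \pi_QZ (bincoef k P)]; split.
  by apply/(binomial_phaseP _ szP) => k; rewrite ffunE.
by move=> c /(binomial_phaseP _ szP) cP; apply/ffunP => k; rewrite ffunE cP.
Qed.

Lemma G_le_coefficients_surj d (c : {ffun 'I_d.+1 -> QZ}) :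
  exists2 u, G_le R d u & binomial_phase c u.
Proof.
pose P := binsum d.+1 (fun k => repr (c (inord k))).
have szP : (size P <= d.+1)%N by apply: size_binsum.
exists (pphase P); first by rewrite G_leE; exists P.
apply/(binomial_phaseP _ szP) => k.
by rewrite bincoef_binsum ltn_ord inord_val reprK.
Qed.

End Closure.

(** * Primary decomposition of Q/Z *)

Section Primary.
Implicit Types (p : nat) (x y : rat).

(** For [p] prime, the localization of [Z] at [p], inside [rat]. *)
Definition p_integral p x :=
  exists2 b : nat, ~~ (p %| b)%N & b%:R * x \is a Num.int.

Lemma p_integral_int p x : prime p -> x \is a Num.int -> p_integral p x.
Proof.
move=> p_pr x_int; exists 1%N; rewrite ?mul1r //.
by rewrite dvdn1 gtn_eqF ?prime_gt1.
Qed.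

Lemma p_integralB p x y : prime p ->
  p_integral p x -> p_integral p y -> p_integral p (x - y).
Proof.
move=> p_pr [b pb bx] [c pc cy]; exists (b * c)%N.
  by rewrite Euclid_dvdM // negb_or pb.
rewrite natrM mulrBr rpredB //; last by rewrite -mulrA rpredM ?natr_int.
by rewrite mulrAC rpredM ?natr_int.
Qed.

Lemma p_integralD p x y : prime p ->
  p_integral p x -> p_integral p y -> p_integral p (x + y).
Proof.
move=> p_pr x_int y_int; rewrite -[y]opprK -[- y]sub0r.
by do 2?apply: p_integralB => //; apply: p_integral_int; rewrite ?rpred0.
Qed.

Lemma coprime_int m n x : coprime m n ->
  m%:R * x \is a Num.int -> n%:R * x \is a Num.int -> x \is a Num.int.
Proof.
move=> mn mx nx; have [u [v uv]] := Bezoutz m n.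
have {}uv : u%:~R * m%:R + v%:~R * n%:R = 1 :> rat.
  have := congr1 (intr : int -> rat) uv; rewrite /gcdz /= (eqP mn).
  by rewrite intrD !intrM.
by rewrite -[x]mul1r -uv mulrDl -!mulrA rpredD // rpredM ?intr_int.
Qed.

(** A power of [p] and an integer prime to [p] both clear the denominator of [x],
    hence so does [1] by Bezout. This makes [p]-parts unique modulo [Z]. *)
Lemma p_denom_p_integral p x :
  prime p -> x \in p_denom p -> p_integral p x -> x \is a Num.int.
Proof.
move=> p_pr /asboolP[n pnx] [b pb]; apply: coprime_int pnx.
by apply: coprimeXl; rewrite prime_coprime.
Qed.

Lemma p_denom_q_integral p q x :
  prime p -> prime q -> p != q -> x \in p_denom p -> p_integral q x.
Proof.
move=> p_pr q_pr pq /asboolP[n pnx]; exists (p ^ n)%N => //.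
by rewrite Euclid_dvdX // dvdn_prime2 // eq_sym (negPf pq).
Qed.

Lemma p_integral_denq p x : ~~ (p %| `|denq x|)%N -> p_integral p x.
Proof.
exists `|denq x|%N => //.
by rewrite mulrC natr_absz gtr0_norm ?denq_gt0 // -numqE intr_int.
Qed.

(** Otherwise take [p] a prime divisor of the denominator of [x]: an integer
    clearing the denominator is a multiple of it, hence of [p]. *)
Lemma p_integral_all_int x :
  (forall p, prime p -> p_integral p x) -> x \is a Num.int.
Proof.
move=> x_int; rewrite Qint_def -absz_denq.
have [D1 | D_neq1] := eqVneq `|denq x|%N 1%N; first by rewrite D1.
have p_pr : prime (pdiv `|denq x|).
  by rewrite pdiv_prime // ltn_neqAle eq_sym D_neq1 absz_gt0 denq_neq0.
have [b /negP pb /intrP[z bx]] := x_int _ p_pr; case: pb.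
apply: (dvdn_trans (pdiv_dvd _)).
rewrite -(@Gauss_dvdl _ _ `|numq x|); last first.
  by rewrite coprime_sym coprime_num_den.
have : b%:Z * numq x = z * denq x.
  by apply: (intr_inj (R := rat)); rewrite !intrM numqE mulrA [_ * x]bx.
by move=> /(congr1 absz); rewrite !abszM => ->; apply: dvdn_mull.
Qed.

(** Write the denominator as [b * p ^ k] with [b] prime to [p], and
    [u * b + v * p ^ k = 1]; then [x = u * b * x + v * p ^ k * x], where the
    first term lies in [Z[1/p]] and [b] clears the second one. *)
Lemma p_part_exists p x : prime p ->
  exists y : Zinv p, p_integral p (x - (y : rat)).
Proof.
move=> p_pr; have D_gt0 : (0 < `|denq x|)%N by rewrite absz_gt0 denq_neq0.
have [b pb Db] := pfactor_coprime p_pr D_gt0.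
set k := logn p _ in Db.
have Dx : b%:R * (p ^ k)%:R * x = (numq x)%:~R.
  rewrite -natrM -Db natr_absz gtr0_norm ?denq_gt0 //.
  by rewrite numqE mulrC.
have [u [v uv]] := Bezoutz b (p ^ k)%N.
have {}uv : u%:~R * b%:R + v%:~R * (p ^ k)%:R = 1 :> rat.
  have := congr1 (intr : int -> rat) uv; rewrite /gcdz /=.
  rewrite (eqP (_ : coprime b (p ^ k))); last by rewrite coprime_sym coprimeXl.
  by rewrite intrD !intrM.
have y_denom : u%:~R * b%:R * x \in p_denom p.
  apply/asboolP; exists k.
  have -> : (p ^ k)%:R * (u%:~R * b%:R * x) =
      u%:~R * (b%:R * (p ^ k)%:R * x) :> rat.
    by rewrite -!mulrA mulrCA; congr (_ * _); rewrite mulrCA.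
  by rewrite Dx rpredM ?intr_int.
exists (MkZinv y_denom); exists b; first by rewrite -prime_coprime.
have -> : b%:R * (x - u%:~R * b%:R * x) = v%:~R * (b%:R * (p ^ k)%:R * x).
  have {1}-> : x = v%:~R * (p ^ k)%:R * x + u%:~R * b%:R * x.
    by rewrite addrC -mulrDl uv mul1r.
  by rewrite addrK -!mulrA mulrCA.
by rewrite Dx rpredM ?intr_int.
Qed.

Local Notation primes := {p : nat | prime p}.

Definition p_part (p : primes) (x : rat) : Zinv (sval p) :=
  sval (cid (p_part_exists x (svalP p))).

Lemma p_partP (p : primes) x : p_integral (sval p) (x - (p_part p x : rat)).
Proof. exact: (svalP (cid (p_part_exists x (svalP p)))). Qed.

Definition p_component (p : primes) (x : rat) : Prufer (sval p) :=
  \pi_(Prufer (sval p)) (p_part p x).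

(** The component does not depend on the choice made in [p_part], hence it is
    additive and vanishes on the [p]-integral rationals. *)
Lemma p_component_eq (p : primes) x (y : Zinv (sval p)) :
  p_integral (sval p) (x - (y : rat)) ->
  p_component p x = \pi_(Prufer (sval p)) y.
Proof.
move=> xy; apply/(quot_eqP (@Zinv_int (sval p) : zmodClosed _)).
have -> : (p_part p x - y \in @Zinv_int (sval p)) =
  ((p_part p x : rat) - (y : rat) \is a Num.int) by [].
apply: (@p_denom_p_integral (sval p)) (svalP p) _ _.
  by rewrite rpredB ?Zinv_denom.
have -> : (p_part p x : rat) - (y : rat) =
    (x - (y : rat)) - (x - (p_part p x : rat)) by ring.
apply: p_integralB (svalP p) xy (p_partP p x).
Qed.

Lemma p_componentB (p : primes) x y :
  p_component p (x - y) = p_component p x - p_component p y.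
Proof.
rewrite -raddfB; apply: p_component_eq.
have -> : x - y - ((p_part p x - p_part p y : Zinv _) : rat) =
  (x - (p_part p x : rat)) - (y - (p_part p y : rat)) by rewrite /=; ring.
apply: p_integralB (svalP p) (p_partP p x) (p_partP p y).
Qed.

Lemma p_component_eq0 (p : primes) x :
  p_component p x = 0 <-> p_integral (sval p) x.
Proof.
rewrite -(raddf0 (\pi_(Prufer (sval p)))); split=> [|x_int]; last first.
  by apply: p_component_eq; rewrite subr0.
move=> /(quot_eqP (@Zinv_int (sval p) : zmodClosed _)); rewrite subr0 => px_int.
rewrite -[x](subrK (p_part p x : rat)).
apply: p_integralD (svalP p) (p_partP p x) (p_integral_int (svalP p) px_int).
Qed.

Lemma finsupp_p_component x :
  (fun p : primes => p_component p x) \in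
    @finsupp primes (fun p : primes => Prufer (sval p)).
Proof.
apply/asboolP; pose B := [set n | (n < `|denq x|.+1)%N].
apply: (@sub_finite_set _ _ ((fun p : primes => sval p) @^-1` B)).
  move=> p /= px; rewrite /B /= ltnS dvdn_leq ?absz_gt0 ?denq_neq0 //.
  by apply: contraTT px => /p_integral_denq/p_component_eq0 ->; rewrite eqxx.
by apply: finite_preimage (finite_II _) => p q _ _ /val_inj.
Qed.

(** Onto: given a finite family of components, add up their representatives. At
    [q], those of the other primes are [q]-integral and do not contribute. *)
Lemma QZ_primary : zmod_iso QZ (dsum (fun p : primes => Prufer (sval p))).
Proof.
pose h x : dsum (fun p : primes => Prufer (sval p)) :=
  DSum (finsupp_p_component x).
have hB : zmod_morphism h.
  move=> x y; apply: dsum_eqP => p.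
  exact: p_componentB.
pose H : {additive _ -> _} := HB.pack h (GRing.isZmodMorphism.Build _ _ h hB).
apply: (@zmod_iso_quot _ _ _ H) => [c | x]; last first.
  split=> [hx0 | x_int].
    apply: p_integral_all_int => p p_pr.
    apply/(p_component_eq0 (exist _ p p_pr)).
    exact: (congr1 (fun s => dsum_val s (exist _ p p_pr)) hx0).
  apply: dsum_eqP => p.
  exact/p_component_eq0/p_integral_int/x_int/(svalP p).
have /asboolP/finite_seqP[s sE] := dsum_finsupp c.
pose y (p : primes) : rat := repr (dsum_val c p).
exists (\sum_(p <- undup s) y p).
apply: dsum_eqP => q.
have others_integral (r : seq primes) : q \notin r ->
    p_integral (sval q) (\sum_(p <- r) y p).
  elim: r => [|p r IHr].
    by rewrite big_nil => _; exact/p_integral_int/rpred0/(svalP q).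
  rewrite big_cons inE negb_or => /andP[qp /IHr r_int].
  apply: p_integralD (svalP q) _ r_int.
  apply: p_denom_q_integral (svalP p) (svalP q) _ (Zinv_denom _).
  by rewrite eq_sym.
have [qs | qs] := boolP (q \in undup s).
  rewrite -[RHS]reprK; apply: p_component_eq.
  rewrite (bigD1_seq q) ?undup_uniq //=.
  rewrite [X in X - _]addrC addrK -big_filter; apply: others_integral.
  by rewrite mem_filter eqxx.
transitivity (0 : Prufer (sval q)); last first.
  apply/esym/eqP; apply: contraNT qs => cq; rewrite mem_undup.
  by have : [set` s] q by rewrite -sE.
exact/p_component_eq0/others_integral.
Qed.

End Primary.

(** * Divisibility, torsion and infinity of the phase groups *)

Lemma G_poly_infinite_divisible_torsion (R : realType) :
  infinite_divisible_torsion_group (G_poly R) (@ptmul R).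
Proof.
apply: (infinite_divisible_torsion_iso (G_poly_iso R)).
- by move=> n a; apply: quot_divisible.
- exact: QX_Int_torsion.
- apply: (quot_infinite (v := 1)) => r /int_valuedP/(_ 0).
  by rewrite hornerZ hornerC mulr1.
Qed.

Lemma G_le_infinite_divisible_torsion (R : realType) (d : nat) :
  infinite_divisible_torsion_group (G_le R d) (@ptmul R).
Proof.
apply: (infinite_divisible_torsion_iso (G_le_iso R d)).
- by move=> n a; apply: quot_divisible.
- exact: QX_Int_le_torsion.
- have sz1 : (size (1%R : {poly rat}) <= d.+1)%N by rewrite size_poly1.
  apply: (quot_infinite (v := NPoly sz1)) => r /int_valuedP/(_ 0).
  by rewrite hornerZ hornerC mulr1.
Qed.

Theorem theorem6p2 (R : realType) :
  (forall d : nat, (1 <= d)%N ->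
     infinite_divisible_torsion_group (G_le R d) (@ptmul R)) /\
  infinite_divisible_torsion_group (G_poly R) (@ptmul R) /\
  (forall d : nat,
     group_iso (G_le R d) (@ptmul R) (QX_Int_le d) /\
     zmod_iso (QX_Int_le d) {ffun 'I_d.+1 -> QZ} /\
     (forall u, G_le R d u ->
        exists! c : {ffun 'I_d.+1 -> QZ}, binomial_phase c u) /\
     (forall c : {ffun 'I_d.+1 -> QZ},
        exists2 u, G_le R d u & binomial_phase c u)) /\
  (group_iso (G_poly R) (@ptmul R) QX_Int /\
   zmod_iso QX_Int (dsum (fun _ : nat => QZ)) /\
   zmod_iso (dsum (fun _ : nat => QZ))
     (dsum (fun _ : nat =>
        dsum (fun p : {p : nat | prime p} => Prufer (sval p))))).
Proof.
split; first by move=> d _; exact: G_le_infinite_divisible_torsion.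
split; first exact: G_poly_infinite_divisible_torsion.
split=> [d|].
  split; first exact: G_le_iso.
  split; first exact: QX_Int_le_iso.
  by split; [exact: G_le_unique_coefficients | exact: G_le_coefficients_surj].
split; first exact: G_poly_iso.
by split; [exact: QX_Int_iso | exact/dsum_map_iso/QZ_primary].
Qed.
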